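(* The homotopy categories $\mathrm{Ho}(\mathrm{ZSet})$ and $\mathrm{Ho}(\mathrm{NSet})$ are both equivalent to the homotopy category $\mathrm{Ho}(\mathrm{Gph})$.
   Context: A graph is $X=(X_0,X_1,s,t)$ with a set $X_0$ of nodes, a set $X_1$ of arcs, and functions $s,t:X_1\to X_0$ (source, target). A graph morphism $f:X\to Y$ is a pair $f_0:X_0\to Y_0$, $f_1:X_1\to Y_1$ with $s f_1=f_0 s$, $t f_1=f_0 t$. This is the category $\mathrm{Gph}$. For $n>0$, the cycle graph $\mathbf{C}_n$ has $\mathbb{Z}/n$ as nodes and as arcs, with $s(i)=i+1$, $t(i)=i$; $C_n(X)$ is the set of graph morphisms $\mathbf{C}_n\to X$. An N-set is a pair $(S,\sigma)$ with $S$ a set and $\sigma:S\to S$ a function; maps of N-sets are functions commuting with the $\sigma$'s; this is $\mathrm{NSet}$. $\mathrm{ZSet}$ is the full subcategory of those $(S,\sigma)$ with $\sigma$ bijective. Write $C_n(S,\sigma)=\{x\in S:\sigma^n(x)=x\}$. Model structures. In each case the cofibrations are the morphisms with the left lifting property with respect to all morphisms that are both weak equivalences and fibrations. In $\mathrm{Gph}$: weak equivalences are the Acyclic morphisms ($C_n(f)$ is bijective for all $n>0$); fibrations are the Surjecting morphisms (for every node $x$, $f$ maps the arcs with source $x$ onto the arcs with source $f(x)$). In $\mathrm{NSet}$: weak equivalences are the Acyclic maps ($C_n(f):C_n(S,\sigma)\to C_n(T,\sigma)$ is bijective for all $n>0$); fibrations are the Surjecting maps ($f:\sigma^{-1}(x)\to\sigma^{-1}(f(x))$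 is surjective for every $x\in S$). In $\mathrm{ZSet}$: weak equivalences are the Acyclic maps (same definition); fibrations are all maps. $\mathrm{Ho}(\mathcal{E})$ denotes the localization of $\mathcal{E}$ at its weak equivalences. *)

(* Defs.v *)
From HB Require Import structures.
From mathcomp Require Import all_boot boolp.

Set Implicit Arguments.
Unset Strict Implicit.
Unset Printing Implicit Defensive.

(* Morphisms are compared with Leibniz equality. *)
Record category := Category {
  ob :> Type;
  hom : ob -> ob -> Type;
  idm : forall a, hom a a;
  comp : forall a b c, hom b c -> hom a b -> hom a c;
  comp_idl : forall a b (f : hom a b), comp (idm b) f = f;
  comp_idr : forall a b (f : hom a b), comp f (idm a) = f;
  comp_assoc : forall a b c d (h : hom c d) (g : hom b c) (f : hom a b),
    comp h (comp g f) = comp (comp h g) f }.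

Arguments idm {c} a : rename.
Arguments comp {c0 a b c} g f : rename.

Record functor (C D : category) := Functor {
  fob :> C -> D;
  fhom : forall a b, hom a b -> hom (fob a) (fob b);
  fhom_id : forall a, fhom (idm a) = idm (fob a);
  fhom_comp : forall a b c (g : hom b c) (f : hom a b),
    fhom (comp g f) = comp (fhom g) (fhom f) }.

Arguments fhom {C D} F {a b} f : rename.

Lemma functor_eq (C D : category) (o : C -> D)
    (h1 h2 : forall a b, hom a b -> hom (o a) (o b)) i1 i2 c1 c2 :
  (forall a b (f : hom a b), h1 a b f = h2 a b f) ->
  @Functor C D o h1 i1 c1 = @Functor C D o h2 i2 c2.
Proof.
move=> h12; have {h12} E : h1 = h2.
  apply: functional_extensionality_dep => a.
  apply: functional_extensionality_dep => b.
  exact: functional_extensionality_dep.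
case: _ / E i2 c2 => i2 c2.
by congr Functor; exact: Prop_irrelevance.
Qed.

Definition functor_id (C : category) : functor C C :=
  @Functor C C id (fun _ _ f => f) (fun=> erefl) (fun _ _ _ _ _ => erefl).

Section FunctorComp.
Variables (C D E : category) (G : functor D E) (F : functor C D).

Let GF a b (f : @hom C a b) : hom (G (F a)) (G (F b)) := fhom G (fhom F f).

Let GF_id a : GF (idm a) = idm (G (F a)).
Proof. by rewrite /GF !fhom_id. Qed.

Let GF_comp a b c (g : @hom C b c) (f : hom a b) :
  GF (comp g f) = comp (GF g) (GF f).
Proof. by rewrite /GF !fhom_comp. Qed.

Definition functor_comp : functor C E :=
  @Functor C E (fun a => G (F a)) GF GF_id GF_comp.
End FunctorComp.

Definition is_iso (C : category) (a b : C) (f : hom a b) : Prop :=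
  exists g : hom b a, comp g f = idm a /\ comp f g = idm b.

Definition naturally_isomorphic (C D : category) (F G : functor C D) : Prop :=
  exists alpha : forall a : C, hom (F a) (G a),
    (forall a, is_iso (alpha a)) /\
    (forall a b (f : hom a b),
       comp (alpha b) (fhom F f) = comp (fhom G f) (alpha a)).

Definition equivalent_categories (C D : category) : Prop :=
  exists (F : functor C D) (G : functor D C),
    naturally_isomorphic (functor_comp G F) (functor_id C) /\
    naturally_isomorphic (functor_comp F G) (functor_id D).

Definition full_subcategory (C : category) (P : C -> Prop) : category :=
  @Category {a : C | P a} (fun a b => hom (sval a) (sval b))
    (fun a => idm (sval a)) (fun _ _ _ g f => comp g f)
    (fun _ _ f => comp_idl f) (fun _ _ f => comp_idr f)
    (fun _ _ _ _ h g f => comp_assoc h g f).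

Definition morphism_class (C : category) := forall a b : C, hom a b -> Prop.

Definition inverts (C D : category) (W : morphism_class C) (F : functor C D) :=
  forall a b (f : hom a b), W a b f -> is_iso (fhom F f).

(* The strict universal property of C[W^-1]. *)
Definition is_localization (C H : category) (W : morphism_class C)
    (L : functor C H) : Prop :=
  inverts W L /\
  forall (D : category) (F : functor C D), inverts W F ->
    exists! F' : functor H D, functor_comp F' L = F.

(* C[W^-1] by generators and relations: same objects as C; a morphism is a
   formal composite of morphisms of C and formal inverses of members of W,
   modulo the least congruence containing the category laws, functoriality of
   word_inc, and the invertibility of W.  Lemma loc_functorP gives its universal
   property. *)
Section Localization.
Variables (C : category) (W : morphism_class C).

Inductive word : C -> C -> Type :=
| word_inc a b of hom a b : word a b
| word_inv a b (w : hom a b) of W w : word b a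
| word_comp a b c of word b c & word a b : word a c.

Inductive word_eq : forall a b, word a b -> word a b -> Prop :=
| word_eq_refl a b (x : word a b) : word_eq x x
| word_eq_sym a b (x y : word a b) : word_eq x y -> word_eq y x
| word_eq_trans a b (x y z : word a b) :
    word_eq x y -> word_eq y z -> word_eq x z
| word_eq_congr a b c (x x' : word b c) (y y' : word a b) :
    word_eq x x' -> word_eq y y' ->
    word_eq (word_comp x y) (word_comp x' y')
| word_eq_idl a b (x : word a b) : word_eq (word_comp (word_inc (idm b)) x) x
| word_eq_idr a b (x : word a b) : word_eq (word_comp x (word_inc (idm a))) x
| word_eq_assoc a b c d (x : word c d) (y : word b c) (z : word a b) :
    word_eq (word_comp x (word_comp y z)) (word_comp (word_comp x y) z)
| word_eq_inc a b c (g : hom b c) (f : hom a b) :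
    word_eq (word_inc (comp g f)) (word_comp (word_inc g) (word_inc f))
| word_eq_invl a b (w : hom a b) (Ww : W w) :
    word_eq (word_comp (word_inv Ww) (word_inc w)) (word_inc (idm a))
| word_eq_invr a b (w : hom a b) (Ww : W w) :
    word_eq (word_comp (word_inc w) (word_inv Ww)) (word_inc (idm b)).

(* A morphism is an equivalence class of words. *)
Definition loc_hom (a b : C) : Type :=
  {P : word a b -> Prop | exists x, P = @word_eq a b x}.

Definition loc_class a b (x : word a b) : loc_hom a b :=
  exist _ (@word_eq a b x) (ex_intro _ x erefl).

Definition loc_repr a b (u : loc_hom a b) : word a b := sval (cid (svalP u)).

Lemma loc_reprK a b (u : loc_hom a b) : loc_class (loc_repr u) = u.
Proof.
rewrite /loc_repr; case: cid => x /=; case: u => P Px /= e.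
by case: _ / (esym e) Px => Px; congr exist; exact: Prop_irrelevance.
Qed.

Lemma loc_classP a b (x y : word a b) :
  loc_class x = loc_class y <-> word_eq x y.
Proof.
split=> [/(congr1 sval) /= -> |xy]; first exact: word_eq_refl.
have e : @word_eq a b x = @word_eq a b y.
  apply: functional_extensionality_dep => z; apply: propositional_extensionality.
  split=> [xz|yz]; last exact: word_eq_trans yz.
  exact: word_eq_trans (word_eq_sym xy) xz.
by apply: eq_exist; rewrite ?e.
Qed.

Lemma loc_classK a b (x : word a b) : word_eq (loc_repr (loc_class x)) x.
Proof. by apply/loc_classP; rewrite loc_reprK. Qed.

Definition loc_comp a b c (u : loc_hom b c) (v : loc_hom a b) : loc_hom a c :=
  loc_class (word_comp (loc_repr u) (loc_repr v)).

Lemma loc_compE a b c (x : word b c) (y : word a b) :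
  loc_comp (loc_class x) (loc_class y) = loc_class (word_comp x y).
Proof. by apply/loc_classP/word_eq_congr; exact: loc_classK. Qed.

Definition loc_id (a : C) : loc_hom a a := loc_class (word_inc (idm a)).

Lemma loc_idl a b (u : loc_hom a b) : loc_comp (loc_id b) u = u.
Proof.
by rewrite -(loc_reprK u) loc_compE; apply/loc_classP/word_eq_idl.
Qed.

Lemma loc_idr a b (u : loc_hom a b) : loc_comp u (loc_id a) = u.
Proof.
by rewrite -(loc_reprK u) loc_compE; apply/loc_classP/word_eq_idr.
Qed.

Lemma loc_assoc a b c d (u : loc_hom c d) (v : loc_hom b c) (w : loc_hom a b) :
  loc_comp u (loc_comp v w) = loc_comp (loc_comp u v) w.
Proof.
rewrite -(loc_reprK u) -(loc_reprK v) -(loc_reprK w) !loc_compE.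
exact/loc_classP/word_eq_assoc.
Qed.

Definition localization : category :=
  Category loc_idl loc_idr loc_assoc.

Let L1 (a b : C) (f : hom a b) : @hom localization a b :=
  loc_class (word_inc f).

Let L1_comp a b c (g : @hom C b c) (f : hom a b) :
  L1 (comp g f) = comp (L1 g) (L1 f).
Proof. by rewrite [RHS]loc_compE; apply/loc_classP/word_eq_inc. Qed.

Definition loc_functor : functor C localization :=
  @Functor C localization id L1 (fun=> erefl) L1_comp.

Lemma loc_functor_inverts : inverts W loc_functor.
Proof.
move=> a b w Ww; exists (loc_class (word_inv Ww)); split.
- by rewrite [LHS]loc_compE; apply/loc_classP/word_eq_invl.
- by rewrite [LHS]loc_compE; apply/loc_classP/word_eq_invr.
Qed.

Lemma loc_inv_unique (D : category) (a b : D) (f : hom a b) (g h : hom b a) :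
  comp g f = idm a -> comp f h = idm b -> g = h.
Proof. by move=> gf fh; rewrite -[g]comp_idr -fh comp_assoc gf comp_idl. Qed.

Section Factor.
Variables (D : category) (F : functor C D) (FW : inverts W F).

Fixpoint word_eval a b (x : word a b) : @hom D (F a) (F b) :=
  match x in word a b return @hom D (F a) (F b) with
  | word_inc _ _ f => fhom F f
  | word_inv _ _ _ Ww => sval (cid (FW Ww))
  | word_comp _ _ _ x y => comp (word_eval x) (word_eval y)
  end.

Lemma word_evalP a b (x y : word a b) :
  word_eq x y -> word_eval x = word_eval y.
Proof.
elim=> //= {a b x y}.
- by move=> a b x y z _ -> _ ->.
- by move=> a b c x x' y y' _ -> _ ->.
- by move=> a b x; rewrite fhom_id comp_idl.
- by move=> a b x; rewrite fhom_id comp_idr.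
- by move=> *; rewrite comp_assoc.
- by move=> *; rewrite fhom_comp.
- by move=> a b w Ww; rewrite fhom_id; case: cid => g [].
- by move=> a b w Ww; rewrite fhom_id; case: cid => g [].
Qed.

Let F1 (a b : localization) (u : hom a b) : @hom D (F a) (F b) :=
  word_eval (loc_repr u).

Let F1E a b (x : word a b) : F1 (loc_class x) = word_eval x.
Proof. exact/word_evalP/loc_classK. Qed.

Let F1_id (a : localization) : F1 (idm a) = idm (F a).
Proof. by rewrite F1E /= fhom_id. Qed.

Let F1_comp (a b c : localization) (u : hom b c) (v : hom a b) :
  F1 (comp u v) = comp (F1 u) (F1 v).
Proof. by rewrite F1E. Qed.

Definition loc_factor : functor localization D :=
  @Functor localization D (fun a => F a) F1 F1_id F1_comp.

Lemma loc_factorE : functor_comp loc_factor loc_functor = F.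
Proof.
transitivity (Functor (@fhom_id _ _ F) (@fhom_comp _ _ F)); last by case: (F).
apply: functor_eq => a b f; exact: F1E.
Qed.

End Factor.

Lemma loc_functor_epi (D : category) (G1 G2 : functor localization D) :
  functor_comp G1 loc_functor = functor_comp G2 loc_functor -> G1 = G2.
Proof.
case: G1 G2 => [o1 h1 i1 c1] [o2 h2 i2 c2] E.
pose T := {o : C -> D & forall a b, @hom C a b -> @hom D (o a) (o b)}.
pose tot (F : functor C D) : T := existT _ (fob F) (fun a b f => fhom F f).
have {E} := congr1 tot E; rewrite /tot /= => E.
have eo : o1 = o2 := congr1 (@projT1 _ _) E.
case: _ / eo h2 i2 c2 E => h2 i2 c2 E.
have {E} E : forall a b (f : @hom C a b),
    h1 a b (loc_class (word_inc f)) = h2 a b (loc_class (word_inc f)).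
  move=> a b f.
  have := projT2_eq E; rewrite (Prop_irrelevance (projT1_eq E) erefl) /=.
  by move/(congr1 (fun k => k a b f)).
have hE a b (x : word a b) : h1 a b (loc_class x) = h2 a b (loc_class x).
  elim: x => {a b} [a b f|a b w Ww|a b c x IHx y IHy].
  - exact: E.
  - have [wl wr] : loc_comp (loc_class (word_inv Ww)) (loc_class (word_inc w))
        = loc_id a
      /\ loc_comp (loc_class (word_inc w)) (loc_class (word_inv Ww)) = loc_id b.
      by rewrite !loc_compE; split; apply/loc_classP;
        [exact: word_eq_invl|exact: word_eq_invr].
    apply: (@loc_inv_unique _ _ _ (h1 _ _ (loc_class (word_inc w)))).
      by rewrite -(c1 a b a) -[RHS]i1; congr h1.
    by rewrite E -(c2 b a b) -[RHS]i2; congr h2.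
  - rewrite -loc_compE.
    by rewrite (c1 a b c) (c2 a b c) IHx IHy.
by apply: functor_eq => a b u; rewrite -(loc_reprK u) hE.
Qed.

Lemma loc_functorP : is_localization W loc_functor.
Proof.
split=> [|D F FW]; first exact: loc_functor_inverts.
exists (loc_factor FW); split; first exact: loc_factorE.
by move=> F' F'E; apply: loc_functor_epi; rewrite F'E loc_factorE.
Qed.

End Localization.

Record graph := Graph {
  node : Type;
  arc : Type;
  source : arc -> node;
  target : arc -> node }.

Record graph_hom (X Y : graph) := GraphHom {
  on_node : node X -> node Y;
  on_arc : arc X -> arc Y;
  source_on_arc : forall e, source (on_arc e) = on_node (source e);
  target_on_arc : forall e, target (on_arc e) = on_node (target e) }.

Lemma graph_hom_eq (X Y : graph) (f g : graph_hom X Y) :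
  on_node f = on_node g -> on_arc f = on_arc g -> f = g.
Proof.
case: f g => [f0 f1 fs ft] [g0 g1 gs gt] /= e0 e1.
case: _ / e0 gs gt => gs gt; case: _ / e1 gs gt => gs gt.
by congr GraphHom; exact: Prop_irrelevance.
Qed.

Definition graph_id (X : graph) : graph_hom X X :=
  @GraphHom X X id id (fun=> erefl) (fun=> erefl).

Section GraphComp.
Variables (X Y Z : graph) (g : graph_hom Y Z) (f : graph_hom X Y).

Let comp_source e :
  source ((on_arc g \o on_arc f) e) = (on_node g \o on_node f) (source e).
Proof. by rewrite /= !source_on_arc. Qed.

Let comp_target e :
  target ((on_arc g \o on_arc f) e) = (on_node g \o on_node f) (target e).
Proof. by rewrite /= !target_on_arc. Qed.

Definition graph_comp : graph_hom X Z := GraphHom comp_source comp_target.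
End GraphComp.

Definition Gph : category.
Proof.
by apply: (@Category graph graph_hom graph_id graph_comp) => *;
  exact: graph_hom_eq.
Defined.

(* 'I_n with the cyclic successor ordS is Z/n for every n > 0; in particular
   cycle_graph 1 is a single loop ('Z_1 would wrongly be Z/2). *)
Definition cycle_graph (n : nat) : graph := @Graph 'I_n 'I_n (@ordS n) id.

Definition graph_cycles (n : nat) (X : graph) : Type :=
  graph_hom (cycle_graph n) X.

Definition graph_cycles_map (n : nat) (X Y : graph) (f : graph_hom X Y) :
  graph_cycles n X -> graph_cycles n Y := fun c => graph_comp f c.

Definition Gph_acyclic : morphism_class Gph :=
  fun X Y f => forall n, 0 < n -> bijective (@graph_cycles_map n X Y f).

Record nset := NSet_ob {
  carrier :> Type;
  step : carrier -> carrier }.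

Record nset_hom (S T : nset) := NSetHom {
  nset_fun :> S -> T;
  nset_funS : forall x, nset_fun (step x) = step (nset_fun x) }.

Lemma nset_hom_eq (S T : nset) (f g : nset_hom S T) :
  nset_fun f = nset_fun g -> f = g.
Proof.
case: f g => [f fS] [g gS] /= e; case: _ / e gS => gS.
by congr NSetHom; exact: Prop_irrelevance.
Qed.

Definition nset_id (S : nset) : nset_hom S S := @NSetHom S S id (fun=> erefl).

Section NSetComp.
Variables (S T U : nset) (g : nset_hom T U) (f : nset_hom S T).

Let comp_step x : (g \o f) (step x) = step ((g \o f) x).
Proof. by rewrite /= !nset_funS. Qed.

Definition nset_comp : nset_hom S U := NSetHom comp_step.
End NSetComp.

Definition NSet : category.
Proof.
by apply: (@Category nset nset_hom nset_id nset_comp) => *;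
  exact: nset_hom_eq.
Defined.

Definition ZSet : category :=
  full_subcategory (fun S : NSet => bijective (@step S)).

Definition nset_cycles (n : nat) (S : nset) : Type :=
  {x : S | iter n (@step S) x = x}.

Lemma nset_fun_iter (S T : nset) (f : nset_hom S T) n x :
  f (iter n (@step S) x) = iter n (@step T) (f x).
Proof. by elim: n => //= n IHn; rewrite nset_funS IHn. Qed.

Lemma nset_cycles_subproof n (S T : nset) (f : nset_hom S T)
  (x : nset_cycles n S) : iter n (@step T) (f (sval x)) = f (sval x).
Proof. by rewrite -nset_fun_iter (svalP x). Qed.

Definition nset_cycles_map (n : nat) (S T : nset) (f : nset_hom S T) :
    nset_cycles n S -> nset_cycles n T :=
  fun x => exist _ (f (sval x)) (nset_cycles_subproof f x).

Definition NSet_acyclic : morphism_class NSet :=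
  fun S T f => forall n, 0 < n -> bijective (@nset_cycles_map n S T f).

Definition ZSet_acyclic : morphism_class ZSet :=
  fun S T f => @NSet_acyclic (sval S) (sval T) f.

(* Only the weak equivalences of the model structures enter into Ho. *)
Definition Ho_Gph : category := localization Gph_acyclic.
Definition Ho_NSet : category := localization NSet_acyclic.
Definition Ho_ZSet : category := localization ZSet_acyclic.

(* Main.v *)
From mathcomp Require Import all_boot boolp.
Require Import Defs.

Set Implicit Arguments.
Unset Strict Implicit.
Unset Printing Implicit Defensive.

(** A functor F that preserves and reflects weak equivalences, with a functor G
    backwards and natural weak equivalences GF -> 1 and FG -> 1, induces an
    equivalence of localizations. For NSet -> Gph, F sends (S, sigma) to the
    graph with arcs sigma(x) -> x, and G sends a graph X to the set of its
    infinite paths (... -> x_2 -> x_1 -> x_0) under the shift. F is fully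
    faithful with right adjoint G, and C_n is the F-image of Z/n, so that
    C_n(X) = Hom(F(Z/n), X) = Hom(F(Z/n), FG X) = C_n(FG X). For ZSet -> NSet,
    F is the inclusion and G(S) is the set of periodic points of S. *)

(** * Injections and bijections of types *)

Lemma sval_inj (T : Type) (P : T -> Prop) : injective (@sval T P).
Proof. by move=> [x px] [y py] /=; exact: eq_exist. Qed.

Lemma inj_surj_bij (A B : Type) (f : A -> B) :
  injective f -> (forall y, exists x, f x = y) -> bijective f.
Proof.
move=> f_inj /choice[g fg]; exists g => //.
by move=> x; apply: f_inj.
Qed.

(** Together with [bij_cancel_pre], this gives two-out-of-three for bijections, used to cancel
    acyclic morphisms and to carry acyclicity across commutative squares. *)
Lemma bij_cancel_post (A B C : Type) (g : B -> C) (f : A -> B) (h : A -> C) :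
  g \o f =1 h -> bijective g -> bijective h -> bijective f.
Proof.
move=> gfh [g' gK g'K] h_bij.
apply: (eq_bij (bij_comp (Bijective g'K gK) h_bij)).
by move=> x; rewrite /= -gfh /= gK.
Qed.

Lemma bij_cancel_pre (A B C : Type) (g : B -> C) (f : A -> B) (h : A -> C) :
  g \o f =1 h -> bijective f -> bijective h -> bijective g.
Proof.
move=> gfh [f' fK f'K] h_bij.
apply: (eq_bij (bij_comp h_bij (Bijective f'K fK))).
by move=> y; rewrite /= -gfh /= f'K.
Qed.

(** * Equivalences of categories *)

Lemma is_iso_comp (C : category) (a b c : C) (g : hom b c) (f : hom a b) :
  is_iso g -> is_iso f -> is_iso (comp g f).
Proof.
move=> [g' [g'g gg']] [f' [f'f ff']]; exists (comp f' g'); split.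
- by rewrite -comp_assoc (comp_assoc g') g'g comp_idl.
- by rewrite -comp_assoc (comp_assoc f) ff' comp_idl.
Qed.

Lemma fhom_iso (C D : category) (F : functor C D) (a b : C) (f : hom a b) :
  is_iso f -> is_iso (fhom F f).
Proof.
by move=> [g [gf fg]]; exists (fhom F g); rewrite -!fhom_comp gf fg !fhom_id.
Qed.

(** Whiskering [be] by [F] and [G] gives GHF -> GF, followed by [al]. When equivalences are
    composed, [H] is the inner round trip. *)
Lemma naturally_isomorphic_insert (C D : category) (F : functor C D)
    (H : functor D D) (G : functor D C) :
  naturally_isomorphic H (functor_id D) ->
  naturally_isomorphic (functor_comp G F) (functor_id C) ->
  naturally_isomorphic (functor_comp G (functor_comp H F)) (functor_id C).
Proof.
move=> [be [be_iso be_nat]] [al [al_iso al_nat]].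
exists (fun a => comp (al a) (fhom G (be (F a)))); split=> [a|a b f] /=.
  exact: is_iso_comp (al_iso a) (fhom_iso G (be_iso (F a))).
rewrite -comp_assoc -fhom_comp.
have /= -> := be_nat _ _ (fhom F f).
by rewrite fhom_comp !comp_assoc; congr comp; exact: al_nat.
Qed.

Lemma equivalent_categories_trans (C D E : category) :
  equivalent_categories C D -> equivalent_categories D E ->
  equivalent_categories C E.
Proof.
move=> [F [G [GF FG]]] [F' [G' [GF' FG']]].
exists (functor_comp F' F), (functor_comp G G'); split.
(* The two bracketings of the four functors differ only in their proofs of functoriality, so the
   same components serve. *)
- have [al al_nat] := naturally_isomorphic_insert GF' GF; by exists al.
- have [al al_nat] := naturally_isomorphic_insert FG FG'; by exists al.
Qed.

(** * Functors and natural transformations on localizations *)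

(** Words are built from morphisms of [C], formal inverses and composites: the square of an inverse
    is the inverted square of [w], and squares of composites are pasted. *)
Lemma loc_natural (C D : category) (W : morphism_class C)
    (G1 G2 : functor (localization W) D)
    (al : forall a : C, hom (G1 a) (G2 a)) :
  (forall (a b : C) (f : hom a b),
     comp (al b) (fhom G1 (fhom (loc_functor W) f)) =
     comp (fhom G2 (fhom (loc_functor W) f)) (al a)) ->
  forall (a b : localization W) (u : hom a b),
    comp (al b) (fhom G1 u) = comp (fhom G2 u) (al a).
Proof.
move=> al_nat a b u; rewrite -(loc_reprK u).
elim: {u}(loc_repr u) => {a b} [a b f|a b w Ww|a b c x IHx y IHy].
- exact: al_nat.
- set v : @hom (localization W) b a := loc_class (word_inv Ww).
  pose lw := fhom (loc_functor W) w.
  have vl : comp v lw = idm (a : localization W).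
    by rewrite [LHS]loc_compE; apply/loc_classP/word_eq_invl.
  have vr : comp lw v = idm (b : localization W).
    by rewrite [LHS]loc_compE; apply/loc_classP/word_eq_invr.
  (* Insert G2(v) G2(w) = 1 on the left, move [al] across the square of [w], and cancel G1(w) G1(v)
     = 1. *)
  rewrite -[LHS]comp_idl -(fhom_id G2) -vl fhom_comp.
  rewrite -comp_assoc (comp_assoc (fhom G2 lw)) -al_nat.
  by rewrite -(comp_assoc _ _ (fhom G1 v)) -fhom_comp vr fhom_id comp_idr.
- rewrite -loc_compE.
  have cE (H : functor (localization W) D) :
      fhom H (loc_comp (loc_class x) (loc_class y)) =
      comp (fhom H (loc_class x)) (fhom H (loc_class y)) by exact: fhom_comp.
  by rewrite !cE comp_assoc IHx -!comp_assoc IHy.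
Qed.

Section LocalizationFunctor.
Variables (C D : category) (W : morphism_class C) (V : morphism_class D).
Variable F : functor C D.
Hypothesis FW : forall a b (f : hom a b), W f -> V (fhom F f).

Lemma loc_functor_comp_inverts : inverts W (functor_comp (loc_functor V) F).
Proof. by move=> a b f /FW; exact: loc_functor_inverts. Qed.

Definition localization_functor : functor (localization W) (localization V) :=
  loc_factor loc_functor_comp_inverts.

Lemma localization_functorE a b (f : @hom C a b) :
  fhom localization_functor (fhom (loc_functor W) f) =
  fhom (loc_functor V) (fhom F f).
Proof.
exact: (word_evalP loc_functor_comp_inverts (loc_classK (word_inc W f))).
Qed.
End LocalizationFunctor.

(** The components of [al] become invertible in the localization, and by [loc_natural] their
    naturality need only be tested on morphisms of [C]. *)
Lemma localization_counit (C D : category) (W : morphism_class C)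
    (V : morphism_class D) (F : functor C D) (G : functor D C)
    (FW : forall a b (f : hom a b), W a b f -> V _ _ (fhom F f))
    (GV : forall a b (f : hom a b), V a b f -> W _ _ (fhom G f))
    (al : forall a, hom (G (F a)) a) :
  (forall a, W _ _ (al a)) ->
  (forall a b (f : hom a b),
     comp (al b) (fhom G (fhom F f)) = comp f (al a)) ->
  naturally_isomorphic
    (functor_comp (localization_functor GV) (localization_functor FW))
    (functor_id (localization W)).
Proof.
move=> alW al_nat.
exists (fun a : C => fhom (loc_functor W) (al a)).
split=> [a|]; first exact: loc_functor_inverts (alW a).
apply: loc_natural => a b f.
have -> : fhom (functor_comp (localization_functor GV)
    (localization_functor FW)) (fhom (loc_functor W) f) =
    fhom (loc_functor W) (fhom G (fhom F f)).
  rewrite -(localization_functorE GV).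
  exact: congr1 (localization_functorE FW f).
by rewrite -[LHS](fhom_comp (loc_functor W)) al_nat [LHS]fhom_comp.
Qed.

Lemma equivalent_localizations (C D : category) (W : morphism_class C)
    (V : morphism_class D) (F : functor C D) (G : functor D C)
    (al : forall a, hom (G (F a)) a) (be : forall b, hom (F (G b)) b) :
  (forall a b c (g : hom b c) (f : hom a b),
     V b c g -> V a b f -> V a c (comp g f)) ->
  (forall a b c (g : hom b c) (f : hom a b),
     V b c g -> V a c (comp g f) -> V a b f) ->
  (forall a b (f : hom a b), W a b f <-> V _ _ (fhom F f)) ->
  (forall a, W _ _ (al a)) ->
  (forall b, V _ _ (be b)) ->
  (forall a b (f : hom a b),
     comp (al b) (fhom G (fhom F f)) = comp f (al a)) ->
  (forall a b (f : hom a b),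
     comp (be b) (fhom F (fhom G f)) = comp f (be a)) ->
  equivalent_categories (localization W) (localization V).
Proof.
move=> V_comp V_cancel FP alW beV al_nat be_nat.
have FW a b (f : hom a b) : W a b f -> V _ _ (fhom F f) by move/FP.
have GV a b (f : hom a b) : V a b f -> W _ _ (fhom G f).
  (* [F] reflects weak equivalences, so F(G f) in [V] suffices. By naturality be F(G f) = f be,
     which lies in [V]; then cancel [be]. *)
  move=> Vf; apply/FP/(V_cancel _ _ _ (be b)) => //.
  by rewrite be_nat; exact: V_comp.
exists (localization_functor FW), (localization_functor GV); split.
- exact: localization_counit alW al_nat.
- exact: localization_counit beV be_nat.
Qed.

(** * Acyclic morphisms *)

Lemma nset_cycles_map_comp n (S T U : nset) (g : nset_hom T U)
    (f : nset_hom S T) :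
  @nset_cycles_map n _ _ g \o @nset_cycles_map n _ _ f =1
  @nset_cycles_map n _ _ (nset_comp g f).
Proof. by move=> x; apply: sval_inj. Qed.

Lemma NSet_acyclic_comp (S T U : NSet) (g : hom T U) (f : hom S T) :
  NSet_acyclic g -> NSet_acyclic f -> NSet_acyclic (comp g f).
Proof.
move=> Wg Wf n n0; apply: eq_bij (nset_cycles_map_comp g f).
exact: bij_comp (Wg n n0) (Wf n n0).
Qed.

Lemma NSet_acyclic_cancel (S T U : NSet) (g : hom T U) (f : hom S T) :
  NSet_acyclic g -> NSet_acyclic (comp g f) -> NSet_acyclic f.
Proof.
move=> Wg Wgf n n0.
exact: bij_cancel_post (nset_cycles_map_comp g f) (Wg n n0) (Wgf n n0).
Qed.

(** A preimage x of an n-periodic y is n-periodic: sigma^n(x) and x have the same image under the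
    injective [f]. *)
Lemma inj_NSet_acyclic (S T : nset) (f : nset_hom S T) :
  injective f ->
  (forall n y, 0 < n -> iter n (@step T) y = y -> exists x, f x = y) ->
  NSet_acyclic f.
Proof.
move=> f_inj f_surj n n0; apply: inj_surj_bij => [[x xn] [y yn]|[y yn]].
  by move/(congr1 sval)/f_inj => /= xy; apply: sval_inj.
have [x fx] := f_surj n y n0 yn.
have xn : iter n (@step S) x = x by apply: f_inj; rewrite nset_fun_iter fx.
by exists (exist (fun x => iter n (@step S) x = x) x xn); apply: sval_inj.
Qed.

Lemma graph_cycles_map_comp n (X Y Z : graph) (g : graph_hom Y Z)
    (f : graph_hom X Y) :
  @graph_cycles_map n _ _ g \o @graph_cycles_map n _ _ f =1
  @graph_cycles_map n _ _ (graph_comp g f).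
Proof. by move=> c; exact: graph_hom_eq. Qed.

Lemma Gph_acyclic_comp (X Y Z : Gph) (g : hom Y Z) (f : hom X Y) :
  Gph_acyclic g -> Gph_acyclic f -> Gph_acyclic (comp g f).
Proof.
move=> Wg Wf n n0; apply: eq_bij (graph_cycles_map_comp g f).
exact: bij_comp (Wg n n0) (Wf n n0).
Qed.

Lemma Gph_acyclic_cancel (X Y Z : Gph) (g : hom Y Z) (f : hom X Y) :
  Gph_acyclic g -> Gph_acyclic (comp g f) -> Gph_acyclic f.
Proof.
move=> Wg Wgf n n0.
exact: bij_cancel_post (graph_cycles_map_comp g f) (Wg n n0) (Wgf n n0).
Qed.

(** * N-sets as graphs *)

(** The direction of the arcs is chosen to agree with [cycle_graph n], which is by conversion the
    graph of Z/n with [ordS]. *)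
Definition nset_graph (S : nset) : graph := @Graph S S (@step S) id.

Definition nset_graph_hom (S T : nset) (f : nset_hom S T) :
    graph_hom (nset_graph S) (nset_graph T) :=
  @GraphHom (nset_graph S) (nset_graph T) f f
    (fun x => esym (nset_funS f x)) (fun=> erefl).

Definition nset_graph_functor : functor NSet Gph.
Proof.
by apply: (@Functor NSet Gph nset_graph nset_graph_hom) => *;
  exact: graph_hom_eq.
Defined.

Lemma iter_ordS m k : val (iter k (@ordS m.+1) ord0) = k %% m.+1.
Proof.
elim: k => [|k IHk] /=; first by rewrite mod0n.
by rewrite IHk -[in LHS]addn1 modnDml addn1.
Qed.

Lemma iter_modn (T : Type) (f : T -> T) n x k :
  iter n f x = x -> iter (k %% n) f x = iter k f x.
Proof.
move=> xn; rewrite {2}(divn_eq k n) addnC iterD; congr iter.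
by elim: (k %/ n) => // q IHq; rewrite mulSn iterD -IHq.
Qed.

Definition nset_graph_cycle n (S : nset) (x : nset_cycles n S) :
  graph_cycles n (nset_graph S).
Proof.
exists (fun i : 'I_n => iter i (@step S) (sval x))
       (fun i : 'I_n => iter i (@step S) (sval x)) => //= i.
(* [ordS] reduces i+1 modulo n, which is harmless as x has period n. *)
by rewrite -iterS (iter_modn i.+1 (svalP x)).
Defined.

(** A cycle amounts to an equivariant map from Z/n, so it is determined by its node at 0, which may
    be any point fixed by sigma^n. *)
Lemma nset_graph_cycle_bij n (S : nset) :
  0 < n -> bijective (@nset_graph_cycle n S).
Proof.
case: n => // m _; apply: inj_surj_bij => [[x xn] [y yn]|c].
  move/(congr1 (fun c : graph_cycles m.+1 _ => on_node c ord0)) => /= xy.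
  exact: sval_inj.
have cE k : on_node c (iter k (@ordS m.+1) ord0) =
    iter k (@step S) (on_node c ord0).
  elim: k => //= k <-; rewrite -[LHS](source_on_arc c) /=; congr step.
  exact: (target_on_arc c).
have ordE (i : 'I_m.+1) : iter i (@ordS m.+1) ord0 = i.
  by apply: val_inj; rewrite iter_ordS modn_small.
(* Going m+1 steps around the cycle returns to 0, so the node there is fixed by sigma^(m+1). *)
have c0 : iter m.+1 (@step S) (on_node c ord0) = on_node c ord0.
  by rewrite -cE; congr (on_node c _); apply: val_inj; rewrite iter_ordS modnn.
exists (exist (fun x => iter m.+1 (@step S) x = x) _ c0).
apply: graph_hom_eq; apply: funext => i /=.
  by rewrite -cE ordE.
by rewrite -cE ordE; rewrite -[LHS](target_on_arc c).
Qed.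

Lemma nset_graph_acyclic (S T : nset) (f : nset_hom S T) :
  NSet_acyclic f <-> Gph_acyclic (nset_graph_hom f).
Proof.
have sq n : @graph_cycles_map n _ _ (nset_graph_hom f) \o @nset_graph_cycle n S
    =1 @nset_graph_cycle n T \o @nset_cycles_map n _ _ f.
  by move=> x; apply: graph_hom_eq; apply: funext => i /=;
    rewrite nset_fun_iter.
split=> Wf n n0.
- apply: bij_cancel_pre (sq n) (nset_graph_cycle_bij S n0) _.
  exact: bij_comp (nset_graph_cycle_bij T n0) (Wf n n0).
- apply: bij_cancel_post (fsym (sq n)) (nset_graph_cycle_bij T n0) _.
  exact: bij_comp (Wf n n0) (nset_graph_cycle_bij S n0).
Qed.

(** * Infinite paths *)

(** Arcs are recorded, not nodes, because arcs may be parallel. The path runs backwards: [e 0] is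
    its last arc. *)
Definition is_path (X : graph) (e : nat -> arc X) : Prop :=
  forall k, source (e k) = target (e k.+1).

Definition graph_path (X : graph) : Type := {e : nat -> arc X | is_path e}.

Definition graph_path_shift (X : graph) (e : graph_path X) : graph_path X :=
  exist (@is_path X) (fun k => sval e k.+1) (fun k => svalP e k.+1).

Definition graph_path_nset (X : graph) : nset :=
  @NSet_ob (graph_path X) (@graph_path_shift X).

Lemma graph_path_map_subproof (X Y : graph) (f : graph_hom X Y)
    (e : graph_path X) :
  is_path (fun k => on_arc f (sval e k)).
Proof. by move=> k; rewrite source_on_arc target_on_arc (svalP e). Qed.

Definition graph_path_map (X Y : graph) (f : graph_hom X Y) :
    nset_hom (graph_path_nset X) (graph_path_nset Y).
Proof.
exists (fun e => exist (@is_path Y) _ (graph_path_map_subproof f e)) => e.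
exact: sval_inj.
Defined.

Definition graph_path_functor : functor Gph NSet.
Proof.
by apply: (@Functor Gph NSet graph_path_nset graph_path_map) => *;
  apply: nset_hom_eq; apply: funext => e; exact: sval_inj.
Defined.

Lemma iter_step_path (X : graph) (e : graph_path_nset X) k j :
  sval (iter k (@step (graph_path_nset X)) e) j = sval e (k + j).
Proof. by elim: k j => //= k IHk j; rewrite IHk addSnnS. Qed.

Definition path_counit (X : graph) :
    graph_hom (nset_graph (graph_path_nset X)) X :=
  @GraphHom (nset_graph (graph_path_nset X)) X
    (fun e => target (sval e 0)) (fun e => sval e 0)
    (fun e => svalP e 0) (fun=> erefl).

Section PathTranspose.
Variables (T : nset) (X : graph) (g : graph_hom (nset_graph T) X).

Lemma path_transpose_subproof t :
  is_path (fun k => on_arc g (iter k (@step T) t)).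
Proof. by move=> k; rewrite source_on_arc target_on_arc. Qed.

(** The adjunct of [g]: t goes to the path of images of the arcs along its orbit. *)
Definition path_transpose : graph_hom (nset_graph T)
    (nset_graph (graph_path_nset X)).
Proof.
pose h t : graph_path X := exist (@is_path X) _ (path_transpose_subproof t).
exists h h => //= t; apply: sval_inj; apply: funext => k /=.
by rewrite -iterSr.
Defined.
End PathTranspose.

(** A morphism [h] between graphs of N-sets is one equivariant map. The k-th arc of h(t) is the last
    arc of its k-th shift h(sigma^k t), so the last arcs determine [h]. *)
Lemma path_counit_universal (T : nset) (X : graph) :
  bijective (fun h : graph_hom (nset_graph T) (nset_graph (graph_path_nset X))
               => graph_comp (path_counit X) h).
Proof.
exists (@path_transpose T X) => [h|g].
- have hE t : on_node h t = on_arc h t.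
    exact: esym (target_on_arc h t).
  have hS k t : on_arc h (iter k (@step T) t) =
      iter k (@step (graph_path_nset X)) (on_arc h t).
    by elim: k => //= k <-; rewrite -hE -[LHS](source_on_arc h).
  have tE t : on_arc (path_transpose (graph_comp (path_counit X) h)) t =
      on_arc h t.
    apply: sval_inj; apply: funext => k /=.
    by rewrite hS iter_step_path addn0.
  apply: graph_hom_eq; apply: funext => t //.
  by rewrite hE -tE.
- apply: graph_hom_eq; apply: funext => t //=.
  exact: target_on_arc.
Qed.

(** The case T = Z/n of the universal property. *)
Lemma path_counit_acyclic (X : graph) : Gph_acyclic (path_counit X).
Proof. by move=> n _; exact: (path_counit_universal (NSet_ob (@ordS n)) X). Qed.

Definition nset_path_head (S : nset) :
    nset_hom (graph_path_nset (nset_graph S)) S :=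
  @NSetHom (graph_path_nset (nset_graph S)) S
    (fun e => sval e 0) (fun e => esym (svalP e 0)).

(** Each node of [nset_graph S] is the target of exactly one arc, so a path is the orbit of its
    head. *)
Lemma nset_path_iter (S : nset) (e : graph_path (nset_graph S)) k :
  sval e k = iter k (@step S) (sval e 0).
Proof. by elim: k => //= k <-; rewrite -[LHS](svalP e k). Qed.

Lemma nset_path_head_acyclic (S : nset) : NSet_acyclic (nset_path_head S).
Proof.
apply: inj_NSet_acyclic => [e e' /= ee'|n x _ _].
  apply: sval_inj; apply: funext => k.
  by rewrite (nset_path_iter e k) ee' -nset_path_iter.
by exists (exist (@is_path (nset_graph S)) (fun k => iter k (@step S) x)
  (fun=> erefl)).
Qed.

Lemma equivalent_Ho_NSet_Gph : equivalent_categories Ho_NSet Ho_Gph.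
Proof.
apply: (@equivalent_localizations _ _ _ _ nset_graph_functor graph_path_functor
  nset_path_head path_counit).
- exact: Gph_acyclic_comp.
- exact: Gph_acyclic_cancel.
- exact: nset_graph_acyclic.
- exact: nset_path_head_acyclic.
- exact: path_counit_acyclic.
- by move=> S T f; exact: nset_hom_eq.
- move=> X Y f; apply: graph_hom_eq; apply: funext => e //=.
  exact: target_on_arc.
Qed.

(** * Periodic points *)

Definition is_periodic (S : nset) (x : S) : Prop :=
  exists2 n, 0 < n & iter n (@step S) x = x.

Definition periodic (S : nset) : Type := {x : S | is_periodic x}.

Lemma periodic_map_subproof (S T : nset) (f : nset_hom S T) (x : periodic S) :
  is_periodic (f (sval x)).
Proof.
by have [n n0 xn] := svalP x; exists n => //; rewrite -nset_fun_iter xn.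
Qed.

(** Viewing sigma as an equivariant map lets [periodic_map_subproof] show that it preserves periodic
    points. *)
Definition nset_step (S : nset) : nset_hom S S :=
  @NSetHom S S (@step S) (fun=> erefl).

Definition periodic_nset (S : nset) : nset :=
  @NSet_ob (periodic S)
    (fun x => exist _ _ (periodic_map_subproof (nset_step S) x)).

Lemma iter_step_periodic (S : nset) (x : periodic_nset S) k :
  sval (iter k (@step (periodic_nset S)) x) = iter k (@step S) (sval x).
Proof. by elim: k => //= k ->. Qed.

Lemma periodic_step_bij (S : nset) : bijective (@step (periodic_nset S)).
Proof.
apply: inj_surj_bij => [[x [n n0 xn]] [y [m m0 ym]]|x].
  move/(congr1 sval) => /= xy; apply: sval_inj => /=.
  (* x and y have the common period n * m. *)
  have per q p z : iter p (@step S) z = z -> iter (q * p) (@step S) z = z.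
    by move=> zp; elim: q => // q IHq; rewrite mulSn iterD IHq.
  (* One more step sigma^(nm-1) turns sigma(x) = sigma(y) into sigma^(nm)(x) = sigma^(nm)(y), that
     is, x = y. *)
  have := congr1 (iter (n * m).-1 (@step S)) xy.
  by rewrite -!iterSr prednK ?muln_gt0 ?n0 //
    (per n m y ym) mulnC (per m n x xn).
have [n n0 xn] := svalP x.
(* If x has period n, then sigma^(n-1)(x) is a preimage of x. *)
exists (iter n.-1 (@step (periodic_nset S)) x); rewrite -iterS prednK //.
by apply: sval_inj; rewrite iter_step_periodic.
Qed.

Definition periodic_map (S T : nset) (f : nset_hom S T) :
  nset_hom (periodic_nset S) (periodic_nset T).
Proof.
exists (fun x => exist _ _ (periodic_map_subproof f x)) => x.
by apply: sval_inj; exact: nset_funS.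
Defined.

Definition periodic_functor : functor NSet ZSet.
Proof.
by apply: (@Functor NSet ZSet
    (fun S => exist _ (periodic_nset S) (periodic_step_bij S)) periodic_map)
  => *; apply: nset_hom_eq; apply: funext => x; exact: sval_inj.
Defined.

Definition ZSet_inclusion : functor ZSet NSet :=
  @Functor ZSet NSet sval (fun _ _ f => f) (fun=> erefl)
    (fun _ _ _ _ _ => erefl).

Definition periodic_inclusion (S : nset) : nset_hom (periodic_nset S) S :=
  @NSetHom (periodic_nset S) S sval (fun=> erefl).

(** Acyclicity only sees points fixed by some sigma^n with n > 0, and these are all periodic. *)
Lemma periodic_inclusion_acyclic (S : nset) :
  NSet_acyclic (periodic_inclusion S).
Proof.
apply: inj_NSet_acyclic => [x y xy|n x n0 xn]; first exact: sval_inj.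
by exists (exist (@is_periodic S) x (ex_intro2 _ _ n n0 xn)).
Qed.

Lemma equivalent_Ho_ZSet_NSet : equivalent_categories Ho_ZSet Ho_NSet.
Proof.
apply: (@equivalent_localizations _ _ _ _ ZSet_inclusion periodic_functor
  (fun S => periodic_inclusion (sval S)) periodic_inclusion).
- exact: NSet_acyclic_comp.
- exact: NSet_acyclic_cancel.
(* Acyclicity in [ZSet] is by definition that of the underlying map. *)
- by [].
- by move=> S; exact: periodic_inclusion_acyclic.
- exact: periodic_inclusion_acyclic.
- by move=> S T f; exact: nset_hom_eq.
- by move=> S T f; exact: nset_hom_eq.
Qed.

Theorem mainTheorem3 :
  equivalent_categories Ho_ZSet Ho_Gph /\
  equivalent_categories Ho_NSet Ho_Gph.
Proof.
split; last exact: equivalent_Ho_NSet_Gph.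
exact: equivalent_categories_trans equivalent_Ho_ZSet_NSet
  equivalent_Ho_NSet_Gph.
Qed.
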